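(* Let $h,k,n$ be integers such that $4\le n$ and $2\le h\le k\le n$, satisfying $h+k\le n$ or $3h+k+1\le 2n$. Then there exists a connected claw-free graph $G$ of order $n$ such that $\gamma(G)=h$ and $\gamma_{11}(G)=k$.
   Context: All graphs are finite, undirected, simple and connected. A graph is claw-free if it has no induced subgraph isomorphic to $K_{1,3}$. A set $S\subseteq V(G)$ is a dominating set if every vertex not in $S$ is adjacent to at least one vertex of $S$; the domination number $\gamma(G)$ is the minimum cardinality of a dominating set. A set $S\subseteq V(G)$ is a perfect dominating set if every vertex not in $S$ is adjacent to exactly one vertex of $S$ (in particular $S=V(G)$ is allowed); $\gamma_{11}(G)$ is the minimum cardinality of a perfect dominating set of $G$. *)

(* Defs.v *)
From mathcomp Require Import all_boot.

Set Implicit Arguments.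
Unset Strict Implicit.
Unset Printing Implicit Defensive.

Record sgraph := SGraph {
  vertex :> finType;
  adj : rel vertex;
  adj_sym : symmetric adj;
  adj_irrefl : irreflexive adj
}.

Arguments adj {_} _ _.

Definition graph_order (G : sgraph) : nat := #|G|.

Definition connected (G : sgraph) : Prop :=
  forall x y : G, connect adj x y.

(* An isomorphism of H onto an induced subgraph of G, seen as a map into G. *)
Definition induced_embedding (H G : sgraph) (f : H -> G) : Prop :=
  injective f /\ forall x y : H, adj (f x) (f y) = adj x y.

Definition has_induced (H G : sgraph) : Prop :=
  exists f : H -> G, induced_embedding f.

Section CompleteBipartite.
Variables m n : nat.

(* Adjacent iff on different sides; (+) is exclusive or. *)
Definition Kmn_adj : rel ('I_m + 'I_n) :=
  fun u v => is_inl u (+) is_inl v.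

Lemma Kmn_adj_sym : symmetric Kmn_adj.
Proof. by move=> u v; rewrite /Kmn_adj addbC. Qed.

Lemma Kmn_adj_irrefl : irreflexive Kmn_adj.
Proof. by move=> u; rewrite /Kmn_adj addbb. Qed.

Definition complete_bipartite : sgraph := SGraph Kmn_adj_sym Kmn_adj_irrefl.

End CompleteBipartite.

Definition claw_free (G : sgraph) : Prop :=
  ~ has_induced (complete_bipartite 1 3) G.

Definition dominating (G : sgraph) (S : {set G}) : bool :=
  [forall v, (v \notin S) ==> [exists u in S, adj v u]].

Definition perfect_dominating (G : sgraph) (S : {set G}) : bool :=
  [forall v, (v \notin S) ==> (#|[set u in S | adj v u]| == 1)].

(* The default [set: G] satisfies both predicates (lemmas below), so these are
   genuine minima. *)
Definition domination_number (G : sgraph) : nat :=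
  #|[arg min_(S < [set: G] | dominating S) #|S| ]|.

Definition perfect_domination_number (G : sgraph) : nat :=
  #|[arg min_(S < [set: G] | perfect_dominating S) #|S| ]|.

Lemma dominatingT (G : sgraph) : dominating [set: G].
Proof. by apply/forallP => v; rewrite inE. Qed.

Lemma perfect_dominatingT (G : sgraph) : perfect_dominating [set: G].
Proof. by apply/forallP => v; rewrite inE. Qed.

(* Main.v *)
Require Import Defs.
From mathcomp Require Import all_boot.
From mathcomp Require Import zify.

(** The witnesses are cliques with pendant parts.  Start from a clique [K] of
    hubs, and give every vertex a label; two vertices are adjacent when both lie
    in [K] or when they carry the same label.  Every neighbourhood is then
    covered by two cliques, so the graph is claw-free.  If each label [i < h] is
    carried both by a hub and by a vertex outside [K], the graph is connected,
    and the outer vertex of label [i] sees only label [i]; so a dominating set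
    meets every label below [h], while one hub of each label dominates:
    the domination number is [h].

    Perfect domination is rigid here ([hub_perfect_dichotomy]): as soon as
    [h >= 2], a perfect dominating set contains all hubs or none.  It contains
    none only if every hub has a label below [h], since any other hub has hubs as
    its only neighbours, the outer labels being all below [h]
    ([hub_perfect_avoid]).  If it contains all hubs, it also contains each outer
    vertex that sees two of them.  The perfect domination number is thus
    controlled by how many hubs share each label.

    For [h + k <= n], take [k] hubs, one for each label below [h] and the rest
    labelled [h], and spread the other [n - k] vertices over the labels below
    [h]: the hubs form a minimum perfect dominating set.  Otherwise put
    [j = n - k < h], take [n - h] hubs and one outer vertex for each label below
    [h]; let [j] of these labels be carried by one hub and the other [h - j] by
    two.  All vertices but the [j] leaves are then forced.  This needs
    [j + 2 (h - j)] hubs with labels below [h] and one more hub with no outer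
    neighbour, that is [2 h - j + 1 <= n - h], which is exactly
    [3 h + k + 1 <= 2 n]. *)

Set Implicit Arguments.
Unset Strict Implicit.
Unset Printing Implicit Defensive.

(** * Perfect dominating sets and minima *)

Section Domination.
Variable G : sgraph.
Implicit Types S : {set G}.

Lemma domination_numberP h S :
    dominating S -> #|S| = h ->
    (forall S', dominating S' -> h <= #|S'|) ->
  domination_number G = h.
Proof.
move=> domS cardS le_h; rewrite /domination_number.
case: arg_minnP => [|M domM minM]; first exact: dominatingT.
by apply/eqP; rewrite eqn_leq le_h // -cardS minM.
Qed.

Lemma perfect_domination_numberP k S :
    perfect_dominating S -> #|S| = k ->
    (forall S', perfect_dominating S' -> k <= #|S'|) ->
  perfect_domination_number G = k.
Proof.
move=> pdS cardS le_k; rewrite /perfect_domination_number.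
case: arg_minnP => [|M pdM minM]; first exact: perfect_dominatingT.
by apply/eqP; rewrite eqn_leq le_k // -cardS minM.
Qed.

Lemma dominating_neighbour S v :
  dominating S -> v \notin S -> exists2 u, u \in S & adj v u.
Proof. by move=> /forallP/(_ v)/implyP domS /domS/exists_inP. Qed.

Lemma perfect_dominating_dominating S : perfect_dominating S -> dominating S.
Proof.
move=> /forallP pdS; apply/forallP => v; apply/implyP => vS.
have /cards1P[u Su] := implyP (pdS v) vS.
by have := set11 u; rewrite -Su inE => ?; apply/existsP; exists u.
Qed.

Lemma perfect_dominating_uniq S v x y :
    perfect_dominating S -> v \notin S -> x \in S -> y \in S ->
  adj v x -> adj v y -> x = y.
Proof.
move=> /forallP/(_ v)/implyP pdS /pdS/cards1P[u Su] xS yS vx vy.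
have /set1P-> : x \in [set u] by rewrite -Su inE xS.
by have /set1P-> : y \in [set u] by rewrite -Su inE yS.
Qed.

End Domination.

(** * Labelled cliques *)

Section HubGraph.
Variables (T : finType) (K : pred T) (l : T -> nat).

Definition hub_adj : rel T :=
  fun u v => (u != v) && (K u && K v || (l u == l v)).

Lemma hub_adj_sym : symmetric hub_adj.
Proof.
by move=> u v; rewrite /hub_adj eq_sym [K u && _]andbC [l u == _]eq_sym.
Qed.

Lemma hub_adj_irrefl : irreflexive hub_adj.
Proof. by move=> u; rewrite /hub_adj eqxx. Qed.

Definition hub_graph : sgraph := SGraph hub_adj_sym hub_adj_irrefl.

(** Each neighbour of the centre shares with it [K] or the label; among three
    neighbours, two share the same thing and hence are adjacent. *)
Lemma hub_claw_free : claw_free hub_graph.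
Proof.
case=> f [inj_f adj_f].
pose c : complete_bipartite 1 3 := inl ord0.
pose e (i : 'I_3) : complete_bipartite 1 3 := inr i.
have centre i : K (f c) && K (f (e i)) || (l (f c) == l (f (e i))).
  by have := adj_f c (e i); rewrite /= /hub_adj /Kmn_adj /= => /andP[].
have leaves i j : i != j ->
    ~~ (K (f (e i)) && K (f (e j)) || (l (f (e i)) == l (f (e j)))).
  move=> neq_ij; have := adj_f (e i) (e j); rewrite /= /hub_adj /Kmn_adj /=.
  by rewrite (inj_eq inj_f) (_ : e i != e j) //= => ->.
pose i0 : 'I_3 := inord 0; pose i1 : 'I_3 := inord 1; pose i2 : 'I_3 := inord 2.
have c0 := centre i0; have c1 := centre i1; have c2 := centre i2.
have /leaves l01 : i0 != i1 by rewrite -val_eqE /= !inordK.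
have /leaves l02 : i0 != i2 by rewrite -val_eqE /= !inordK.
have /leaves l12 : i1 != i2 by rewrite -val_eqE /= !inordK.
move: l01 l02 l12 c0 c1 c2; move: (f c) (f (e i0)) (f (e i1)) (f (e i2)) => z x y t.
case: (K z) (K x) (K y) (K t) => [] [] [] [] //=; lia.
Qed.

Variable h : nat.
Hypothesis outer_label : forall v, ~~ K v -> l v < h.
Hypothesis label_hub : forall i, i < h -> exists2 c, K c & l c = i.
Hypothesis label_outer : forall i, i < h -> exists2 u, ~~ K u & l u = i.

Lemma hub_connected : connected hub_graph.
Proof.
have same (x y : hub_graph) : K x && K y || (l x == l y) -> connect adj x y.
  move=> xy; have [->|neq_xy] := eqVneq x y; first exact: connect0.
  by apply: connect1; rewrite /= /hub_adj neq_xy.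
have to_hub (x : hub_graph) : exists2 c, K c & l c = l x \/ c = x.
  have [Kx|/outer_label/label_hub[c Kc lc]] := boolP (K x).
    by exists x => //; right.
  by exists c => //; left.
move=> x y; have [c Kc cx] := to_hub x; have [d Kd dy] := to_hub y.
have xc : connect (adj : rel hub_graph) x c.
  by apply: same; case: cx => ->; rewrite eqxx orbT.
have cd : connect (adj : rel hub_graph) c d by apply: same; rewrite Kc Kd.
have dy' : connect (adj : rel hub_graph) d y.
  by apply: same; case: dy => ->; rewrite eqxx orbT.
exact: connect_trans xc (connect_trans cd dy').
Qed.

(** The outer vertex of label [i] has neighbours of label [i] only. *)
Lemma hub_dominating_label (S : {set hub_graph}) i :
  dominating S -> i < h -> exists2 v, v \in S & l v = i.
Proof.
move=> domS /label_outer[u Ku lu].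
have [uS|uS] := boolP (u \in S); first by exists u.
have [v vS] := dominating_neighbour domS uS.
rewrite /= /hub_adj (negbTE Ku) /= => /andP[_ /eqP uv].
by exists v; rewrite // -uv.
Qed.

Lemma hub_dominating_card (S : {set hub_graph}) : dominating S -> h <= #|S|.
Proof.
move=> domS; rewrite -(size_iota 0 h) -(size_image (l : hub_graph -> nat)).
apply: (uniq_leq_size (iota_uniq 0 h)) => i; rewrite mem_iota => /= ltih.
have [v vS <-] := hub_dominating_label domS ltih; exact: image_f.
Qed.

Lemma hub_dominating (S : {set hub_graph}) :
    0 < h -> (forall i, i < h -> exists2 c, c \in S & K c /\ l c = i) ->
  dominating S.
Proof.
move=> h_gt0 repS; apply/forallP => v; apply/implyP => vS.
have neq c : c \in S -> v != c by apply: contraTneq => <-.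
apply/exists_inP; have [Kv|/outer_label/repS[c cS [Kc lc]]] := boolP (K v).
  have [c cS [Kc _]] := repS _ h_gt0.
  by exists c; rewrite //= /hub_adj neq // Kv Kc.
by exists c; rewrite //= /hub_adj neq // lc eqxx orbT.
Qed.

(** If [S] contains a hub [x] but misses a hub [y], then [x] is its only hub,
    since [y] sees all of them.  A hub [c] with a label [i < h] other than that
    of [x] is then outside [S], and sees both [x] and a vertex of [S] of
    label [i]. *)
Lemma hub_perfect_dichotomy (S : {set hub_graph}) :
    1 < h -> perfect_dominating S ->
  (forall v, K v -> v \in S) \/ (forall v, K v -> v \notin S).
Proof.
move=> h_gt1 pdS.
have [/existsP[x /andP[Kx xS]]|/existsPn noK] :=
    boolP [exists x : hub_graph, K x && (x \in S)]; last first.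
  by right=> v Kv; have := noK v; rewrite Kv.
left=> y Ky; apply/negPn/negP => yS.
have hub_uniq z : K z -> z \in S -> z = x.
  move=> Kz zS.
  have ny w : w \in S -> y != w by apply: contraTneq => <-.
  by apply: (perfect_dominating_uniq pdS yS) => //=;
    rewrite /hub_adj ny // Ky ?Kz ?Kx.
have [i lt_ih neq_ix] : exists2 i, i < h & i != l x.
  by have [lx0|lx0] := eqVneq (l x) 0; [exists 1 | exists 0];
    rewrite ?lx0 // 1?eq_sym // ltnW.
have [c Kc lc] := label_hub lt_ih.
have [w wS lw] := hub_dominating_label (perfect_dominating_dominating pdS) lt_ih.
have cS : c \notin S.
  by apply/negP => /(hub_uniq _ Kc) cx; rewrite -lc cx eqxx in neq_ix.
have nc z : z \in S -> c != z by apply: contraTneq => <-.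
have wx : w = x.
  by apply: (perfect_dominating_uniq pdS cS) => //=;
    rewrite /hub_adj nc // ?Kc ?Kx // lc lw eqxx orbT.
by rewrite -lw wx eqxx in neq_ix.
Qed.

Lemma hub_perfect_avoid (S : {set hub_graph}) :
    dominating S -> (forall v, K v -> v \notin S) ->
  forall v, K v -> l v < h.
Proof.
move=> domS avoid v Kv; have [u uS] := dominating_neighbour domS (avoid v Kv).
have Ku : ~~ K u by apply: contraL uS => /avoid.
by rewrite /= /hub_adj (negbTE Ku) andbF => /andP[_ /eqP->]; apply: outer_label.
Qed.

End HubGraph.

(** * The two families of graphs *)

Lemma card_ord_lt n k : k <= n -> #|[set v : 'I_n | v < k]| = k.
Proof.
move=> le_kn; have inj_widen : injective (widen_ord le_kn).
  by move=> i j /(congr1 val) /= eq_ij; apply: val_inj.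
rewrite -[RHS]card_ord -(card_imset _ inj_widen).
apply: eq_card => v; rewrite inE; apply/idP/imsetP => [lt_vk|[i _ ->]] //=.
by exists (Ordinal lt_vk) => //; apply: val_inj.
Qed.

(** Both families live on ['I_n], with the first [m] vertices as hubs and with
    vertex [i] carrying label [i] for [i < h], so that [{v | v < h}] is a minimum
    dominating set and [{v | v < k}] a minimum perfect one.  The latter set is
    perfect dominating when no vertex outside it shares its label with two of its
    members.  A perfect dominating set with all hubs contains it when each outer
    vertex below [k] sees two hubs; one without hubs has [h] elements at least,
    and is excluded, if [h < k], by a hub with no outer neighbour. *)
Lemma hub_realization n m h k (l : nat -> nat) :
    1 < h -> h <= m -> m <= k -> h <= k -> k <= n ->
    (forall i, i < h -> l i = i) ->
    (forall i, i < h -> exists2 u, m <= u < n & l u = i) ->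
    (forall v, m <= v < n -> l v < h) ->
    (forall v w, k <= v < n -> w < k -> l w = l v -> w = l v) ->
    (forall v, m <= v < k ->
      exists x y, [/\ x < m, y < m, x != y, l x = l v & l y = l v]) ->
    (h < k -> exists2 v, v < m & h <= l v) ->
  exists G : sgraph,
    [/\ connected G, claw_free G, graph_order G = n,
        domination_number G = h & perfect_domination_number G = k].
Proof.
move=> h_gt1 le_hm le_mk le_hk le_kn l_id l_onto l_lt l_uniq l_two l_big.
pose K := [pred v : 'I_n | v < m]; pose lab (v : 'I_n) := l v.
have le_mn := leq_trans le_mk le_kn.
have outerP (v : 'I_n) : ~~ K v -> lab v < h.
  by rewrite /= -leqNgt => le_mv; apply: l_lt; rewrite le_mv ltn_ord.
have port i : i < h -> {c : 'I_n | val c = i & K c /\ lab c = i}.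
  move=> lt_ih; have lt_im := leq_trans lt_ih le_hm.
  by exists (Ordinal (leq_trans lt_im le_mn)); rewrite //= /lab /= l_id.
have hubP i : i < h -> exists2 c, K c & lab c = i.
  by case/port=> c _ [Kc lc]; exists c.
have labP i : i < h -> exists2 u, ~~ K u & lab u = i.
  move=> /l_onto[u /andP[le_mu lt_un] lu].
  by exists (Ordinal lt_un); rewrite //= -leqNgt.
exists (hub_graph K lab); split.
- exact: hub_connected outerP hubP.
- exact: hub_claw_free.
- exact: card_ord.
- apply: (@domination_numberP (hub_graph K lab) _ [set v : 'I_n | v < h]).
  + apply: (hub_dominating outerP) => [|i lt_ih]; first exact: ltnW.
    by have [c ci Klc] := port i lt_ih; exists c; rewrite // inE ci.
  + by rewrite card_ord_lt // (leq_trans le_hk).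
  + by move=> S; apply: (hub_dominating_card labP).
apply: (@perfect_domination_numberP (hub_graph K lab) _ [set v : 'I_n | v < k]).
- apply/forallP => v; apply/implyP; rewrite inE -leqNgt => le_kv.
  have le_mv := leq_trans le_mk le_kv.
  have lt_lv : lab v < h by apply: outerP; rewrite /= -leqNgt.
  have [c cv [Kc lc]] := port _ lt_lv.
  apply/cards1P; exists c; apply/setP => w; rewrite !inE /= /hub_adj.
  have -> /= : K v = false by apply/negbTE; rewrite /= -leqNgt.
  apply/and3P/eqP => [[lt_wk _ /eqP lvw]|->].
    apply: val_inj; rewrite cv; apply: l_uniq => //.
    by rewrite le_kv ltn_ord.
  have lt_ck : c < k by apply: leq_trans Kc le_mk.
  split=> //; last by rewrite lc.
  by apply: contraTneq lt_ck => <-; rewrite -leqNgt.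
- exact: card_ord_lt.
move=> S pdS; have domS := perfect_dominating_dominating pdS.
have [KS|avoid] := hub_perfect_dichotomy hubP labP h_gt1 pdS.
  rewrite -{1}(card_ord_lt le_kn); apply/subset_leq_card/subsetP => v.
  rewrite inE => lt_vk; have [/KS//|] := boolP (K v).
  rewrite /= -leqNgt => le_mv; apply/negPn/negP => vS.
  have [|x [y [lt_xm lt_ym neq_xy lx ly]]] := l_two v; first by rewrite le_mv.
  pose ox : 'I_n := Ordinal (leq_trans lt_xm le_mn).
  pose oy : 'I_n := Ordinal (leq_trans lt_ym le_mn).
  have nv w : w \in S -> v != w by apply: contraTneq => <-.
  have [oxS oyS] : ox \in S /\ oy \in S by split; apply: KS.
  have /(congr1 val) /= eq_xy : ox = oy :> 'I_n.
    by apply: (perfect_dominating_uniq pdS vS) => //=;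
      rewrite /hub_adj nv // /lab /= ?lx ?ly eqxx orbT.
  by rewrite eq_xy eqxx in neq_xy.
have [lt_hk|le_kh] := ltnP h k; last first.
  exact: leq_trans le_kh (hub_dominating_card labP domS).
have [v lt_vm] := l_big lt_hk.
have /= := @hub_perfect_avoid _ _ _ _ outerP _ domS avoid
  (Ordinal (leq_trans lt_vm le_mn)) lt_vm.
by rewrite /lab /= ltnNge => /negPf->.
Qed.

Theorem theorem7 (h k n : nat) (hn : 4 <= n) (hh : 2 <= h) (hhk : h <= k)
    (hkn : k <= n) (hcond : h + k <= n \/ 3 * h + k + 1 <= 2 * n) :
  exists G : sgraph,
    [/\ connected G, claw_free G, graph_order G = n,
        domination_number G = h & perfect_domination_number G = k].
Proof.
have [le_hkn|lt_nhk] := leqP (h + k) n.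
  (* The outer vertices carry the labels 0, 1, ..., h - 1, and all further ones
     repeat the last label. *)
  apply: (@hub_realization n k h k
    (fun v => if v < k then minn v h else minn (v - k) h.-1)) => //.
  - by move=> i lt_ih; case: ifP; lia.
  - by move=> i lt_ih; exists (k + i); [|case: ifP]; lia.
  - by move=> v; case: ifP; lia.
  - by move=> v w; do 2 case: ifP; lia.
  - by move=> v; lia.
  - by exists h; [|case: ifP]; lia.
(* The labels carried by two hubs are those below h - j = h + k - n. *)
apply: (@hub_realization n (n - h) h k
  (fun v => if v < h then v
            else if v < h + (h + k - n) then v - h
            else if v < n - h then h else v - (n - h))) => //; try lia.
- by move=> i ->.
- by move=> i lt_ih; exists (n - h + i); [|repeat case: ifP]; lia.
- by move=> v; repeat case: ifP; lia.
- by move=> v w; repeat case: ifP; lia.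
- move=> v le_v; exists (v - (n - h)), (h + (v - (n - h))).
  by split; repeat case: ifP; lia.
- by exists (n - h).-1; repeat case: ifP; lia.
Qed.
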